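(* Let $\alpha=1/2$ and $\beta\in(0,1)$. The period $P_\lambda(\beta)$ of the loop level set $\lambda$ through $\left(\beta\sqrt{\tfrac13},\ \beta\sqrt{\tfrac23},\ \sqrt{1-\beta^2}\right)$ is given by $$P_\lambda(\beta)=\frac{4\sqrt{3}}{\beta\sqrt{e^{t_0-t_1}+2e^{t_1}}}\cdot K\left(\frac{2(e^{t_1}-e^{-t_0})}{e^{t_0-t_1}+2e^{t_1}}\right)$$ where $$t_0=\log\left(\frac{1}{\beta}\left(\frac{1}{(-\beta^3+\sqrt{-1+\beta^6})^{1/3}}+(-\beta^3+\sqrt{-1+\beta^6})^{1/3}\right)\right)$$ and $$t_1=\log\left(\frac12\left(\frac1{\beta^2}+\frac{1}{\beta^4\left(-2+\frac1{\beta^6}+\frac{2\sqrt{-1+\beta^6}}{\beta^3}\right)^{1/3}}+\left(-2+\frac1{\beta^6}+\frac{2\sqrt{-1+\beta^6}}{\beta^3}\right)^{1/3}\right)\right).$$ Here square and cube roots are principal complex roots.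
   Context: On the unit sphere of $\mathbb{R}^3$ consider the vector field $\Sigma(x,y,z)=(xz,-\tfrac12yz,\tfrac12y^2-x^2)$ (this is the geodesic flow, in the left-invariant orthonormal frame $e^{z}\partial_x,\,e^{-z/2}\partial_y,\,\partial_z$, of the Lie group $G_{1/2}=\mathbb{R}^3$ with metric $ds^2=e^{-2z}dx^2+e^{z}dy^2+dz^2$). For $\beta\in(0,1)$ the integral curve of $\Sigma$ through the given vector is closed (a loop level set $\lambda$ of $|x|^{1/2}y$), and $P_\lambda(\beta)$ is the time it takes the flow of $\Sigma$ to go exactly once around it. $K(m)=\int_0^{\pi/2}\frac{d\theta}{\sqrt{1-m\sin^2\theta}}$ is the complete elliptic integral of the first kind as a function of the parameter $m$. *)

(* Defs.v *)
From Stdlib Require Import Reals Lra.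
From Coquelicot Require Import Coquelicot.

Open Scope R_scope.

(* Principal branches on Coquelicot's [C]. The argument lies in (-PI, PI];
   [Carg 0] and [Clog 0] are junk values. *)
Definition Carg (z : C) : R :=
  if Rlt_dec (Im z) 0 then - acos (Re z / Cmod z) else acos (Re z / Cmod z).

Definition Clog (z : C) : C := (ln (Cmod z), Carg z).

Definition Cexp (z : C) : C :=
  (exp (Re z) * cos (Im z), exp (Re z) * sin (Im z)).

Definition Croot (n : nat) (z : C) : C :=
  if Ceq_dec z (RtoC 0) then RtoC 0 else Cexp (Clog z / RtoC (INR n))%C.

Definition Csqrt (z : C) : C := Croot 2 z.
Definition Ccbrt (z : C) : C := Croot 3 z.

(* A function of the parameter m = k^2, not of the modulus k. *)
Definition elliptic_K (m : R) : R :=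
  RInt (fun theta => / sqrt (1 - m * (sin theta) ^ 2)) 0 (PI / 2).

Definition R3 : Type := (R * R * R)%type.

Definition Sigma (p : R3) : R3 :=
  let '(x, y, z) := p in (x * z, - (1 / 2) * y * z, 1 / 2 * y ^ 2 - x ^ 2).

Definition on_sphere (p : R3) : Prop :=
  let '(x, y, z) := p in x ^ 2 + y ^ 2 + z ^ 2 = 1.

Definition H_half (p : R3) : R :=
  let '(x, y, _) := p in sqrt (Rabs x) * y.

(* At a nonzero level, the level set of [H_half] on the sphere consists of two
   loops exchanged by x |-> -x; the sign condition selects the one through
   [v]. *)
Definition loop_level_set (v p : R3) : Prop :=
  on_sphere p /\ H_half p = H_half v /\ 0 < fst (fst p) * fst (fst v).

Definition flow_line (v : R3) (g : R -> R3) : Prop :=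
  g 0 = v /\ forall t : R, is_derive g t (Sigma (g t)).

Definition once_around (g : R -> R3) (L : R3 -> Prop) (T : R) : Prop :=
  0 < T /\ g T = g 0 /\
  (forall s t : R, 0 <= s < T -> 0 <= t < T -> g s = g t -> s = t) /\
  (forall p : R3, L p <-> exists t : R, 0 <= t < T /\ g t = p).

(* The flow line through [v] is unique (Sigma is smooth); quantifying both
   existentially and universally makes the period independent of any
   uniqueness theorem and never vacuous. *)
Definition is_loop_period (v : R3) (T : R) : Prop :=
  (exists g : R -> R3, flow_line v g) /\
  (forall g : R -> R3, flow_line v g -> once_around g (loop_level_set v) T).

Definition start (beta : R) : R3 :=
  (beta * sqrt (1 / 3), beta * sqrt (2 / 3), sqrt (1 - beta ^ 2)).

(* Main.v *)
(** Along the flow, s = x / (beta sqrt(1/3)) satisfies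
    s'^2 = (beta^2/3) s (b - s) (s - a) (s + a + b), where a < 1 < b are the
    positive roots of s^3 - (3/beta^2) s + 2.  Viete's trigonometric solution of
    this cubic identifies the two nested radicals: e^t0 = b and e^t1 = 1/a.
    The substitution s = a b / (b - (b - a) sin^2 theta) turns the equation into
    theta' = kappa sqrt(1 - m sin^2 theta), whose right-hand side never vanishes.
    The flow line is therefore obtained by inverting the incomplete elliptic
    integral, and it closes up exactly when theta has grown by PI, that is, after
    time 2 K(m) / kappa. *)

Require Import Defs.
From Stdlib Require Import Reals Lra Lia.
From Coquelicot Require Import Coquelicot.

Open Scope R_scope.

(** * Principal roots in polar form *)

Lemma Cmod_polar (r psi : R) (hr : 0 < r) : Cmod (r * cos psi, r * sin psi) = r.
Proof.
  unfold Cmod; simpl fst; simpl snd.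
  replace ((r * cos psi) ^ 2 + (r * sin psi) ^ 2) with (r ^ 2).
  - apply sqrt_pow2; lra.
  - generalize (sin2_cos2 psi); unfold Rsqr; intro H.
    replace (r ^ 2) with (r ^ 2 * (sin psi * sin psi + cos psi * cos psi))
      by (rewrite H; ring).
    ring.
Qed.

Lemma Carg_polar (r psi : R) (hr : 0 < r) (hpsi : 0 <= psi <= PI) :
  Carg (r * cos psi, r * sin psi) = psi.
Proof.
  unfold Carg; rewrite Cmod_polar by exact hr; simpl Re; simpl Im.
  assert (0 <= sin psi) by (apply sin_ge_0; lra).
  destruct (Rlt_dec (r * sin psi) 0) as [h | _]; [nra |].
  replace (r * cos psi / r) with (cos psi) by (field; lra).
  apply acos_cos; lra.
Qed.

Lemma Clog_RtoC (r : R) (hr : 0 < r) : Clog (RtoC r) = RtoC (ln r).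
Proof.
  generalize PI_RGT_0; intro hpi.
  replace (RtoC r) with ((r * cos 0, r * sin 0) : C)
    by (rewrite cos_0, sin_0; unfold RtoC; f_equal; ring).
  unfold Clog; rewrite Cmod_polar, Carg_polar; [reflexivity | lra..].
Qed.

(** On [[0, PI]] the angle [psi] is its own principal argument, so the principal root merely divides
    it by [n]. Writing the modulus as [r ^ n] avoids real [n]-th roots. *)
Lemma Croot_polar (n : nat) (r psi : R) (hn : (0 < n)%nat) (hr : 0 < r)
  (hpsi : 0 <= psi <= PI) :
  Croot n ((r ^ n) * cos psi, (r ^ n) * sin psi) =
  (r * cos (psi / INR n), r * sin (psi / INR n)).
Proof.
  assert (hrn : 0 < r ^ n) by (apply pow_lt; exact hr).
  assert (hN : INR n <> 0) by (apply not_0_INR; lia).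
  unfold Croot.
  destruct (Ceq_dec _ _) as [h0 | _].
  { apply (f_equal Cmod) in h0; rewrite Cmod_polar, Cmod_0 in h0 by exact hrn; lra. }
  unfold Clog; rewrite Cmod_polar, Carg_polar by assumption.
  rewrite ln_pow by exact hr.
  assert (E : Cdiv (INR n * ln r, psi)%R (RtoC (INR n)) = (ln r, psi / INR n)).
  { unfold Cdiv; rewrite <- RtoC_inv by exact hN.
    unfold Cmult, RtoC; simpl; f_equal; field; exact hN. }
  rewrite E; unfold Cexp; simpl Re; simpl Im; rewrite exp_ln by exact hr.
  reflexivity.
Qed.

Lemma Csqrt_neg (r : R) (hr : 0 < r) : Csqrt (RtoC (- r)) = (0, sqrt r).
Proof.
  generalize PI_RGT_0; intro hpi.
  assert (h : 0 < sqrt r) by (apply sqrt_lt_R0; exact hr).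
  replace (RtoC (- r)) with ((sqrt r ^ 2 * cos PI, sqrt r ^ 2 * sin PI) : C).
  - unfold Csqrt; rewrite Croot_polar; [| lia | lra | lra].
    replace (INR 2) with 2 by (simpl; ring).
    rewrite cos_PI2, sin_PI2; f_equal; ring.
  - rewrite cos_PI, sin_PI, pow2_sqrt by lra; unfold RtoC; f_equal; ring.
Qed.

Lemma Cinv_polar (r psi : R) (hr : 0 < r) :
  Cinv (r * cos psi, r * sin psi)%R = (/ r * cos psi, - (/ r * sin psi)).
Proof.
  unfold Cinv; simpl fst; simpl snd.
  replace ((r * cos psi) ^ 2 + (r * sin psi) ^ 2) with (r ^ 2).
  - f_equal; field; lra.
  - generalize (sin2_cos2 psi); unfold Rsqr; intro H.
    replace (r ^ 2) with (r ^ 2 * (sin psi * sin psi + cos psi * cos psi))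
      by (rewrite H; ring).
    ring.
Qed.

(** * Evaluation of the nested radicals by angle trisection *)

Lemma Csqrt_cube (beta : R) (hb : 0 < beta < 1) :
  Csqrt (-(1) + beta ^ 6)%C = (0, sqrt (1 - beta ^ 6)).
Proof.
  assert (h : 0 < beta ^ 6 < 1).
  { split; [apply pow_lt; lra |].
    apply pow_lt_1_compat; lra || lia. }
  rewrite <- RtoC_pow, <- RtoC_opp, <- RtoC_plus.
  replace (- (1) + beta ^ 6) with (- (1 - beta ^ 6)) by ring.
  apply Csqrt_neg; lra.
Qed.

(* [- beta^3 + i sqrt(1 - beta^6) = e^(3 i phi)] for [phi := trisected beta]. *)
Definition trisected (beta : R) : R := (PI - acos (beta ^ 3)) / 3.

(** The bounds put both [3 * phi] and [6 * phi - PI] into [[0, PI]], where the principal cube root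
    divides the angle by three. They also fix the signs and the order of the roots of the cubic. *)
Lemma trisected_spec (beta : R) (hb : 0 < beta < 1) :
  PI / 6 < trisected beta < PI / 3 /\
  cos (3 * trisected beta) = - beta ^ 3 /\
  sin (3 * trisected beta) = sqrt (1 - beta ^ 6).
Proof.
  assert (h : 0 < beta ^ 3 < 1).
  { split; [apply pow_lt; lra |].
    apply pow_lt_1_compat; lra || lia. }
  assert (hc : 0 < acos (beta ^ 3) < PI / 2).
  { assert (hpos := acos_bound_lt (beta ^ 3) ltac:(lra)).
    split; [lra |].
    apply cos_decreasing_0; try lra.
    rewrite cos_PI2, cos_acos; lra. }
  unfold trisected.
  replace (3 * ((PI - acos (beta ^ 3)) / 3)) with (PI - acos (beta ^ 3)) by field.
  split; [lra | split].
  - rewrite Rtrigo_facts.cos_pi_minus, cos_acos by lra; reflexivity.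
  - rewrite Rtrigo_facts.sin_pi_minus, sin_acos by lra.
    f_equal; unfold Rsqr; ring.
Qed.

Lemma Cplus_pair (a b c d : R) : Cplus (a, b)%R (c, d)%R = (a + c, b + d).
Proof. reflexivity. Qed.

(** The cube root is [e^(i phi)], of modulus 1, so its inverse is its conjugate and the imaginary
    parts cancel. *)
Lemma log_argument0 (beta : R) (hb : 0 < beta < 1) :
  (1 / beta *
    (1 / Ccbrt (- beta ^ 3 + Csqrt (-(1) + beta ^ 6))
     + Ccbrt (- beta ^ 3 + Csqrt (-(1) + beta ^ 6))))%C =
  RtoC (2 * cos (trisected beta) / beta).
Proof.
  destruct (trisected_spec beta hb) as [hphi [hcos hsin]].
  set (phi := trisected beta) in *.
  rewrite Csqrt_cube by exact hb.
  assert (E : Cplus (- beta ^ 3)%C (0, sqrt (1 - beta ^ 6))%R =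
              (1 ^ 3 * cos (3 * phi), 1 ^ 3 * sin (3 * phi))).
  { rewrite <- RtoC_pow, <- RtoC_opp; unfold RtoC; rewrite Cplus_pair, hcos, hsin.
    f_equal; ring. }
  rewrite E; unfold Ccbrt; rewrite Croot_polar; [| lia | lra | lra].
  replace (3 * phi / INR 3) with phi by (simpl; field).
  unfold Cdiv at 2; rewrite Cinv_polar, Cmult_1_l, Cplus_pair by lra.
  unfold Cdiv; rewrite <- RtoC_inv, Cmult_1_l by lra.
  unfold Cmult, RtoC; simpl; f_equal; field; lra.
Qed.

(** The radicand is [- (e^(3 i phi) / beta^3)^2], that is, [beta^(-6) e^(i (6 phi - PI))]. Its cube
    root has modulus [beta^(-2)], so the factor [beta^4] makes the inverted term the conjugate of
    the last one. *)
Lemma log_argument1 (beta : R) (hb : 0 < beta < 1) :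
  (1 / 2 *
    (1 / beta ^ 2
     + 1 / (beta ^ 4 *
            Ccbrt (-(2) + 1 / beta ^ 6 + 2 * Csqrt (-(1) + beta ^ 6) / beta ^ 3))
     + Ccbrt (-(2) + 1 / beta ^ 6 + 2 * Csqrt (-(1) + beta ^ 6) / beta ^ 3)))%C =
  RtoC ((1 + 2 * cos (2 * trisected beta - PI / 3)) / (2 * beta ^ 2)).
Proof.
  destruct (trisected_spec beta hb) as [hphi [hcos hsin]].
  set (phi := trisected beta) in *.
  rewrite Csqrt_cube by exact hb.
  assert (hpow : forall n, beta ^ n <> 0) by (intro n; apply pow_nonzero; lra).
  assert (hb2 : 0 < / beta ^ 2) by (apply Rinv_0_lt_compat, pow_lt; lra).
  assert (E : (-(2) + 1 / beta ^ 6 + 2 * (0, sqrt (1 - beta ^ 6))%R / beta ^ 3)%C =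
              ((/ beta ^ 2) ^ 3 * cos (6 * phi - PI),
               (/ beta ^ 2) ^ 3 * sin (6 * phi - PI))).
  { unfold Cdiv; rewrite <- !RtoC_pow, <- !RtoC_inv, <- RtoC_opp, Cmult_1_l
      by apply hpow.
    replace (6 * phi - PI) with (- (PI - 2 * (3 * phi))) by ring.
    rewrite cos_neg, sin_neg, Rtrigo_facts.cos_pi_minus, Rtrigo_facts.sin_pi_minus.
    rewrite cos_2a_cos, sin_2a, hcos, hsin.
    unfold Cmult, Cplus, RtoC; simpl; f_equal; field; lra. }
  rewrite E; unfold Ccbrt; rewrite Croot_polar; [| lia | lra | lra].
  replace ((6 * phi - PI) / INR 3) with (2 * phi - PI / 3) by (simpl; field).
  set (psi := 2 * phi - PI / 3).
  assert (F : Cmult (RtoC beta ^ 4) (/ beta ^ 2 * cos psi, / beta ^ 2 * sin psi)%R =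
              (beta ^ 2 * cos psi, beta ^ 2 * sin psi)).
  { rewrite <- RtoC_pow; unfold Cmult, RtoC; simpl; f_equal; field; lra. }
  rewrite F; unfold Cdiv.
  rewrite Cinv_polar by (apply pow_lt; lra).
  rewrite !Cmult_1_l, <- RtoC_pow, <- !RtoC_inv by (apply hpow || lra).
  unfold Cmult, Cplus, RtoC; simpl; f_equal; field; lra.
Qed.

(** * The two positive roots of the cubic *)

Lemma cubic_roots (beta : R) (hb : 0 < beta < 1) :
  exists a b : R,
    0 < a < 1 /\ 1 < b /\ a * b * (a + b) = 2 /\
    beta ^ 2 * (a ^ 2 + a * b + b ^ 2) = 3 /\
    2 * cos (trisected beta) / beta = b /\
    (1 + 2 * cos (2 * trisected beta - PI / 3)) / (2 * beta ^ 2) = / a.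
Proof.
  destruct (trisected_spec beta hb) as [hphi [hcos _]].
  set (phi := trisected beta) in *.
  assert (hpi := PI_RGT_0).
  assert (hC : 0 < cos phi) by (apply cos_gt_0; lra).
  (* Up to positive factors, [h1] says [0 < a] and [h2] says [a < b]. *)
  assert (h1 : 0 < sin (phi - PI / 6)) by (apply sin_gt_0; lra).
  assert (h2 : 0 < sin (PI / 3 - phi)) by (apply sin_gt_0; lra).
  rewrite sin_minus, sin_PI6, cos_PI6 in h1.
  rewrite sin_minus, sin_PI3, cos_PI3 in h2.
  assert (hq : sqrt 3 * sqrt 3 = 3) by (apply sqrt_sqrt; lra).
  assert (hq0 : 0 < sqrt 3) by (apply sqrt_lt_R0; lra).
  assert (hS := sin2_cos2 phi); unfold Rsqr in hS.
  replace (3 * phi) with (2 * phi + phi) in hcos by ring.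
  rewrite cos_plus, cos_2a_cos, sin_2a in hcos.
  rewrite cos_minus, cos_2a_cos, sin_2a, cos_PI3, sin_PI3.
  set (C := cos phi) in *; set (S := sin phi) in *; set (q := sqrt 3) in *.
  (* The triple-angle formula for [cos (3 * phi) = - beta ^ 3]; the left side is
     [beta ^ 3 * (a * b * (a + b))] for the witnesses below. *)
  assert (hcube : 2 * C * (3 * (S * S) - C * C) = 2 * beta ^ 3).
  { replace (S * S) with (1 - C * C) by lra.
    replace (beta ^ 3) with (- (4 * C ^ 3 - 3 * C)); [ring |].
    assert (S * S = 1 - C * C) by lra.
    replace (4 * C ^ 3 - 3 * C) with
      ((2 * C * C - 1) * C - 2 * (1 - C * C) * C) by ring.
    replace (1 - C * C) with (S * S) by lra; lra. }
  (* Viete's roots [2 * cos (phi - 2 * PI / 3) / beta] and [2 * cos phi / beta]. *)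
  exists ((q * S - C) / beta), (2 * C / beta).
  assert (ha : 0 < (q * S - C) / beta) by (apply Rdiv_lt_0_compat; lra).
  assert (hab : (q * S - C) / beta < 2 * C / beta).
  { apply Rmult_lt_compat_r; [apply Rinv_0_lt_compat; lra |]. nra. }
  assert (hprod : (q * S - C) / beta * (2 * C / beta) *
                  ((q * S - C) / beta + 2 * C / beta) = 2).
  { replace ((q * S - C) / beta * (2 * C / beta) *
             ((q * S - C) / beta + 2 * C / beta))
      with (2 * C * (q * q * (S * S) - C * C) / beta ^ 3) by (field; lra).
    rewrite hq, hcube; field; lra. }
  assert (hsum : beta ^ 2 * (((q * S - C) / beta) ^ 2 +
                   (q * S - C) / beta * (2 * C / beta) + (2 * C / beta) ^ 2) = 3).
  { replace (beta ^ 2 * _) with (q * q * (S * S) + 3 * (C * C)) by (field; lra).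
    rewrite hq; lra. }
  (* The left side equals [b * (a + b) / 2], which is [/ a] by [hprod]. *)
  assert (hinv : (1 + 2 * ((2 * C * C - 1) * (1 / 2) + 2 * S * C * (q / 2))) /
                 (2 * beta ^ 2) = / ((q * S - C) / beta)).
  { apply Rmult_eq_reg_l with ((q * S - C) / beta); [| lra].
    rewrite Rinv_r by lra.
    transitivity (2 / 2); [| field].
    transitivity ((q * S - C) / beta * (2 * C / beta) *
                  ((q * S - C) / beta + 2 * C / beta) / 2); [field; lra |].
    rewrite hprod; reflexivity. }
  set (a := (q * S - C) / beta) in *; set (b := 2 * C / beta) in *.
  (* [3 / beta^2 - 3 > 0] says that 1 lies between the two positive roots. *)
  assert (hmid : 0 < (b - 1) * (1 - a)).
  { assert (hb2 : 0 < beta ^ 2 < 1) by nra.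
    assert (3 < a ^ 2 + a * b + b ^ 2) by nra.
    nra. }
  assert (1 < b) by nra.
  assert (a < 1) by nra.
  repeat split; assumption || reflexivity.
Qed.

(** * The incomplete elliptic integral and its inverse *)

Definition elliptic_F (m theta : R) : R :=
  RInt (fun u => / sqrt (1 - m * (sin u) ^ 2)) 0 theta.

Lemma elliptic_radicand (m u : R) (hm : 0 <= m < 1) :
  0 < 1 - m * sin u ^ 2 <= 1.
Proof. assert (h := SIN_bound u); assert (0 <= sin u ^ 2 <= 1) by nra; nra. Qed.

Lemma elliptic_integrand_ge_1 (m u : R) (hm : 0 <= m < 1) :
  1 <= / sqrt (1 - m * sin u ^ 2).
Proof.
  destruct (elliptic_radicand m u hm) as [h0 h1].
  apply Rle_trans with (/ 1); [rewrite Rinv_1; lra |].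
  apply Rinv_le_contravar; [apply sqrt_lt_R0; exact h0 |].
  rewrite <- sqrt_1 at 2; apply sqrt_le_1_alt; exact h1.
Qed.

Lemma continuous_elliptic_integrand (m u : R) (hm : 0 <= m < 1) :
  continuous (fun u => / sqrt (1 - m * (sin u) ^ 2)) u.
Proof.
  destruct (elliptic_radicand m u hm) as [h0 _].
  apply (ex_derive_continuous (fun u => / sqrt (1 - m * (sin u) ^ 2))); auto_derive.
  assert (0 < sqrt (1 - m * sin u ^ 2)) by (apply sqrt_lt_R0; exact h0).
  change (0 < 1 - m * sin u ^ 2 /\ sqrt (1 - m * sin u ^ 2) <> 0 /\ True).
  repeat split; lra.
Qed.

Lemma is_derive_elliptic_F (m theta : R) (hm : 0 <= m < 1) :
  is_derive (elliptic_F m) theta (/ sqrt (1 - m * (sin theta) ^ 2)).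
Proof.
  apply (is_derive_RInt (fun u => / sqrt (1 - m * (sin u) ^ 2)) (elliptic_F m) 0).
  - apply filter_forall; intro x.
    apply (RInt_correct (fun u => / sqrt (1 - m * (sin u) ^ 2)) 0 x).
    apply (ex_RInt_continuous (V := R_CompleteNormedModule)).
    intros u _; apply continuous_elliptic_integrand; exact hm.
  - apply continuous_elliptic_integrand; exact hm.
Qed.

Lemma is_derive_eq (f g : R -> R) (x y : R)
  (h : forall t, is_derive (fun t => f t - g t) t 0) : f x - g x = f y - g y.
Proof.
  destruct (MVT_gen (fun t => f t - g t) x y (fun _ => 0)) as [c [_ hc]].
  - intros t _; apply h.
  - intros t _; apply continuity_pt_filterlim, (ex_derive_continuous (fun t => f t - g t)).
    eexists; apply h.
  - lra.
Qed.

(** The integrand is at least 1. This single estimate yields strict monotonicity, surjectivity and a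
    1-Lipschitz inverse. *)
Lemma elliptic_F_expand (m x y : R) (hm : 0 <= m < 1) (hxy : x <= y) :
  y - x <= elliptic_F m y - elliptic_F m x.
Proof.
  destruct (MVT_gen (elliptic_F m) x y (fun t => / sqrt (1 - m * (sin t) ^ 2)))
    as [c [_ hc]].
  - intros t _; apply is_derive_elliptic_F; exact hm.
  - intros t _; apply continuity_pt_filterlim, (ex_derive_continuous (elliptic_F m)).
    eexists; apply is_derive_elliptic_F; exact hm.
  - rewrite hc; assert (h := elliptic_integrand_ge_1 m c hm); nra.
Qed.

Lemma elliptic_F_0 (m : R) : elliptic_F m 0 = 0.
Proof. exact (RInt_point (V := R_CompleteNormedModule) 0 _). Qed.

Lemma elliptic_F_opp (m theta : R) (hm : 0 <= m < 1) :
  elliptic_F m (- theta) = - elliptic_F m theta.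
Proof.
  assert (H := is_derive_eq (fun t => elliptic_F m (- t))
                            (fun t => - elliptic_F m t) theta 0).
  cbv beta in H; rewrite Ropp_0, elliptic_F_0 in H.
  enough (forall t, is_derive (fun t => elliptic_F m (- t) - - elliptic_F m t) t 0)
    as h by (specialize (H h); lra).
  intro t.
  auto_derive.
  - repeat split; eexists; apply is_derive_elliptic_F; exact hm.
  - rewrite !(is_derive_unique _ _ _ (is_derive_elliptic_F m _ hm)), sin_neg.
    replace ((- sin t) ^ 2) with (sin t ^ 2) by ring; ring.
Qed.

(** The integrand has period [PI], so the increment over [PI] is constant; at [- (PI / 2)] oddness
    shows it to be twice [elliptic_K m]. *)
Lemma elliptic_F_PI (m theta : R) (hm : 0 <= m < 1) :
  elliptic_F m (theta + PI) = elliptic_F m theta + 2 * elliptic_K m.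
Proof.
  assert (H := is_derive_eq (fun t => elliptic_F m (t + PI)) (elliptic_F m)
                            theta (- (PI / 2))).
  cbv beta in H; rewrite (elliptic_F_opp m (PI / 2) hm) in H.
  replace (- (PI / 2) + PI) with (PI / 2) in H by field.
  change (elliptic_F m (PI / 2)) with (elliptic_K m) in H.
  enough (forall t, is_derive (fun t => elliptic_F m (t + PI) - elliptic_F m t) t 0)
    as h by (specialize (H h); lra).
  intro t.
  auto_derive.
  - repeat split; eexists; apply is_derive_elliptic_F; exact hm.
  - rewrite !(is_derive_unique _ _ _ (is_derive_elliptic_F m _ hm)), neg_sin.
    replace ((- sin t) ^ 2) with (sin t ^ 2) by ring; ring.
Qed.

(** A sigma type, so that projection defines an inverse function. Expansion and oddness bracket [u]
    between the values at [- (Rabs u + 1)] and [Rabs u + 1]. *)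
Lemma elliptic_F_surj (m u : R) (hm : 0 <= m < 1) :
  {theta : R | elliptic_F m theta = u}.
Proof.
  assert (hcont : continuity (fun t => elliptic_F m t - u)).
  { intro t; apply continuity_pt_filterlim,
      (ex_derive_continuous (fun t => elliptic_F m t - u)).
    auto_derive; eexists; apply is_derive_elliptic_F; exact hm. }
  assert (hN : 0 <= Rabs u) by apply Rabs_pos.
  assert (hu := Rabs_def2 u (Rabs u + 1) ltac:(lra)).
  destruct (IVT_cor (fun t => elliptic_F m t - u) (- (Rabs u + 1)) (Rabs u + 1)
              hcont ltac:(lra)) as [t [_ ht]].
  - assert (h := elliptic_F_expand m 0 (Rabs u + 1) hm ltac:(lra)).
    rewrite elliptic_F_0 in h.
    rewrite elliptic_F_opp by exact hm; nra.
  - exists t; lra.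
Qed.

(** By [hexp], [g] is 1-Lipschitz, so the increment [k = g (x + h) - g x] tends to 0 with [h]. It is
    nonzero because [f] undoes [g], and the difference quotient of [g] at [h] is the inverse of that
    of [f] at [k]. *)
Lemma is_derive_inverse (f g : R -> R) (df x : R)
  (hfg : forall y, f (g y) = y)
  (hexp : forall u v, u <= v -> v - u <= f v - f u)
  (hf : is_derive f (g x) df) (hdf : df <> 0) : is_derive g x (/ df).
Proof.
  apply is_derive_Reals; apply is_derive_Reals in hf.
  assert (hlip : forall h, Rabs (g (x + h) - g x) <= Rabs h).
  { intro h; assert (h1 := hexp (g (x + h)) (g x)); assert (h2 := hexp (g x) (g (x + h))).
    rewrite !hfg in h1, h2.
    unfold Rabs; destruct (Rcase_abs h), (Rcase_abs (g (x + h) - g x));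
     destruct (Rle_lt_dec (g x) (g (x + h))); lra. }
  assert (hinv : limit1_in (fun k => / ((f (g x + k) - f (g x)) / k))
             (fun k => k <> 0) (/ df) 0).
  { apply limit_inv; [| exact hdf].
    intros eps heps; destruct (hf eps heps) as [d hd].
    exists d; split; [apply cond_pos |].
    intros k [hk hkd]; simpl in *; unfold Rdist in *.
    rewrite Rminus_0_r in hkd; apply hd; assumption. }
  intros eps heps; destruct (hinv eps heps) as [d [hd H]].
  exists (mkposreal d hd); intros h hh hhd; simpl in hhd.
  assert (hk : g (x + h) - g x <> 0).
  { intro e; apply hh.
    assert (E : g (x + h) = g x) by lra.
    apply (f_equal f) in E; rewrite !hfg in E; lra. }
  specialize (H (g (x + h) - g x)); simpl in H; unfold Rdist in H.
  replace (g x + (g (x + h) - g x)) with (g (x + h)) in H by ring.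
  rewrite !hfg, Rminus_0_r in H.
  replace (/ ((x + h - x) / (g (x + h) - g x))) with ((g (x + h) - g x) / h) in H
    by (field; split; lra).
  apply H; split; [exact hk |].
  apply Rle_lt_trans with (Rabs h); [apply hlip | exact hhd].
Qed.

(** Jacobi's amplitude function and its differential equation. *)
Lemma elliptic_amplitude (m : R) (hm : 0 <= m < 1) :
  exists am : R -> R,
    (forall u, elliptic_F m (am u) = u) /\
    (forall u, is_derive am u (sqrt (1 - m * sin (am u) ^ 2))).
Proof.
  exists (fun u => proj1_sig (elliptic_F_surj m u hm)).
  assert (h : forall u, elliptic_F m (proj1_sig (elliptic_F_surj m u hm)) = u)
    by (intro u; exact (proj2_sig (elliptic_F_surj m u hm))).
  split; [exact h | intro u].
  rewrite <- (Rinv_inv (sqrt _)).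
  apply (is_derive_inverse (elliptic_F m)).
  - exact h.
  - intros; apply elliptic_F_expand; assumption.
  - apply is_derive_elliptic_F; exact hm.
  - assert (h1 := elliptic_integrand_ge_1 m (proj1_sig (elliptic_F_surj m u hm)) hm).
    lra.
Qed.

(** * Coordinatewise differentiation of curves in [R3] *)

Lemma is_derive_R3 (g : R -> R3) (t dx dy dz : R) :
  is_derive g t (dx, dy, dz) <->
  is_derive (fun s => fst (fst (g s))) t dx /\
  is_derive (fun s => snd (fst (g s))) t dy /\
  is_derive (fun s => snd (g s)) t dz.
Proof.
  assert (proj : forall (U V : NormedModule R_AbsRing) (f : R -> U * V) (l : U * V),
    is_derive f t l ->
    is_derive (fun s => fst (f s)) t (fst l) /\ is_derive (fun s => snd (f s)) t (snd l)).
  { intros U V f l h; split.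
    - exact (filterdiff_comp' f fst t _ fst h (filterdiff_linear fst is_linear_fst)).
    - exact (filterdiff_comp' f snd t _ snd h (filterdiff_linear snd is_linear_snd)). }
  assert (pair : forall (U V : NormedModule R_AbsRing) (f : R -> U * V) (l : U * V),
    is_derive (fun s => fst (f s)) t (fst l) ->
    is_derive (fun s => snd (f s)) t (snd l) -> is_derive f t l).
  { intros U V f l h1 h2.
    apply is_derive_ext with (fun s => (fst (f s), snd (f s))).
    { intro s; destruct (f s); reflexivity. }
    destruct l as [l1 l2].
    apply (filterdiff_comp'_2 (fun s => fst (f s)) (fun s => snd (f s)) pair t
             _ _ pair h1 h2).
    apply filterdiff_linear, is_linear_prod; [apply is_linear_fst | apply is_linear_snd]. }
  split.
  - intro h; destruct (proj _ _ _ _ h) as [h1 h2]; destruct (proj _ _ _ _ h1); auto.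
  - intros [hx [hy hz]]; apply pair; [apply pair |]; assumption.
Qed.

(** * Forward uniqueness of the flow *)

Lemma flow_coordinates (g : R -> R3) (hg : forall t, is_derive g t (Sigma (g t))) :
  exists x y z : R -> R, (forall t, g t = (x t, y t, z t)) /\
    forall t, is_derive (fun s : R => x s) t (x t * z t) /\
              is_derive (fun s : R => y s) t (- (1 / 2) * y t * z t) /\
              is_derive (fun s : R => z s) t (1 / 2 * y t ^ 2 - x t ^ 2).
Proof.
  exists (fun t => fst (fst (g t))), (fun t => snd (fst (g t))), (fun t => snd (g t)).
  split; intro t.
  - destruct (g t) as [[x y] z]; reflexivity.
  - apply is_derive_R3; specialize (hg t); unfold Sigma in hg.
    destruct (g t) as [[x y] z]; exact hg.
Qed.

(** [Sigma p] is orthogonal to [p], so the squared norm has derivative 0. *)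
Lemma sphere_invariant (g : R -> R3) (h0 : on_sphere (g 0))
  (hg : forall t, is_derive g t (Sigma (g t))) (t : R) : on_sphere (g t).
Proof.
  destruct (flow_coordinates g hg) as [x [y [z [E hd]]]].
  rewrite E in h0 |- *; unfold on_sphere in *.
  assert (H := is_derive_eq (fun s => x s ^ 2 + y s ^ 2 + z s ^ 2) (fun _ => 0) t 0).
  cbv beta in H; rewrite h0 in H.
  enough (forall s, is_derive (fun s => x s ^ 2 + y s ^ 2 + z s ^ 2 - 0) s 0)
    as hc by (specialize (H hc); lra).
  intro s; destruct (hd s) as [hx [hy hz]].
  auto_derive.
  - repeat split; eexists; eassumption.
  - rewrite (is_derive_unique _ _ _ hx), (is_derive_unique _ _ _ hy),
      (is_derive_unique _ _ _ hz); simpl; field.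
Qed.

(* Gronwall: on the sphere the squared distance of two flow lines grows at
   most like [exp (4 * t)]. *)
Lemma flow_line_unique (v : R3) (g h : R -> R3) (t : R) (hv : on_sphere v)
  (hg : flow_line v g) (hh : flow_line v h) (ht : 0 <= t) : g t = h t.
Proof.
  destruct hg as [g0 hg], hh as [h0 hh].
  assert (Sg := sphere_invariant g ltac:(rewrite g0; exact hv) hg).
  assert (Sh := sphere_invariant h ltac:(rewrite h0; exact hv) hh).
  destruct (flow_coordinates g hg) as [x [y [z [Eg dg]]]].
  destruct (flow_coordinates h hh) as [x' [y' [z' [Eh dh]]]].
  set (E := fun s => ((x s - x' s) ^ 2 + (y s - y' s) ^ 2 + (z s - z' s) ^ 2) *
                     exp (- 4 * s)).
  assert (hE : forall s, exists d, is_derive E s d /\ d <= 0).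
  { intro s; destruct (dg s) as [hx [hy hz]], (dh s) as [hx' [hy' hz']].
    assert (Sgs := Sg s); assert (Shs := Sh s).
    rewrite Eg in Sgs; rewrite Eh in Shs; unfold on_sphere in Sgs, Shs.
    unfold E; eexists; split.
    - auto_derive; [repeat split; eexists; eassumption | reflexivity].
    - rewrite (is_derive_unique _ _ _ hx), (is_derive_unique _ _ _ hy),
        (is_derive_unique _ _ _ hz), (is_derive_unique _ _ _ hx'),
        (is_derive_unique _ _ _ hy'), (is_derive_unique _ _ _ hz').
      revert Sgs Shs; clear.
      generalize (x s) (y s) (z s) (x' s) (y' s) (z' s) (exp_pos (- 4 * s)).
      generalize (exp (- 4 * s)); clear.
      intros e x y z x' y' z' he Sgs Shs.
      (* Since [Sigma] is quadratic, polarization writes each difference of products through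
         coordinate differences and means. The sphere confines the means to [[-1, 1]], and the
         remaining quadratic form in the differences stays below 4 times the squared distance. *)
      match goal with |- ?l <= 0 => replace l with
        (e * (2 * (x - x') ^ 2 * ((z + z') / 2)
              - 2 * ((x - x') * (z - z')) * ((x + x') / 2)
              - (y - y') ^ 2 * ((z + z') / 2)
              + (y - y') * (z - z') * ((y + y') / 2)
              - 4 * ((x - x') ^ 2 + (y - y') ^ 2 + (z - z') ^ 2))) by field end.
      assert (mean : forall p q, p ^ 2 <= 1 -> q ^ 2 <= 1 -> -1 <= (p + q) / 2 <= 1)
        by (intros p q hp hq; assert (-1 <= p <= 1) by nra;
            assert (-1 <= q <= 1) by nra; lra).
      assert (hsq := pow2_ge_0).
      assert (hX : -1 <= (x + x') / 2 <= 1)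
        by (apply mean; generalize (hsq y) (hsq z) (hsq y') (hsq z'); lra).
      assert (hY : -1 <= (y + y') / 2 <= 1)
        by (apply mean; generalize (hsq x) (hsq z) (hsq x') (hsq z'); lra).
      assert (hZ : -1 <= (z + z') / 2 <= 1)
        by (apply mean; generalize (hsq y) (hsq x) (hsq y') (hsq x'); lra).
      revert hX hY hZ.
      generalize ((x + x') / 2) ((y + y') / 2) ((z + z') / 2).
      generalize (x - x') (y - y') (z - z').
      intros p q r X Y Z hX hY hZ; clear - he hX hY hZ.
      assert (p ^ 2 * Z <= p ^ 2) by nra.
      assert (- (q ^ 2 * Z) <= q ^ 2) by nra.
      assert (amgm : forall u w c, -1 <= c <= 1 -> 2 * (u * w) * c <= u ^ 2 + w ^ 2).
      { intros u w c hc.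
        assert (0 <= (u - w) ^ 2) by apply pow2_ge_0.
        assert (0 <= (u + w) ^ 2) by apply pow2_ge_0. nra. }
      assert (h1 := amgm p r (- X) ltac:(lra)).
      assert (h2 := amgm q r Y ltac:(lra)).
      assert (0 <= p ^ 2) by apply pow2_ge_0.
      assert (0 <= q ^ 2) by apply pow2_ge_0.
      assert (0 <= r ^ 2) by apply pow2_ge_0.
      apply Rle_trans with (e * 0); [| lra].
      apply Rmult_le_compat_l; lra. }
  assert (hmono : E t <= E 0).
  { destruct (MVT_gen E 0 t (Derive E)) as [c [_ hc]].
    - intros s _; destruct (hE s) as [d [hd _]]; apply Derive_correct; exists d; exact hd.
    - intros s _; destruct (hE s) as [d [hd _]].
      apply continuity_pt_filterlim, (ex_derive_continuous E); exists d; exact hd.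
    - destruct (hE c) as [d [hd hneg]].
      rewrite (is_derive_unique _ _ _ hd) in hc; nra. }
  assert (h00 : g 0 = h 0) by congruence.
  rewrite Eg, Eh in h00; injection h00 as ex ey ez.
  unfold E in hmono; rewrite ex, ey, ez, !Rminus_diag in hmono.
  assert (hexp := exp_pos (-4 * t)).
  assert (hsum : (x t - x' t) ^ 2 + (y t - y' t) ^ 2 + (z t - z' t) ^ 2 <= 0) by nra.
  assert (hsq := pow2_ge_0).
  assert (sq0 : forall u w, (u - w) ^ 2 <= 0 -> u = w).
  { intros u w huw; enough (u - w = 0) by lra.
    apply Rsqr_0_uniq; unfold Rsqr; specialize (hsq (u - w)); simpl in *; lra. }
  rewrite Eg, Eh.
  generalize (hsq (x t - x' t)) (hsq (y t - y' t)) (hsq (z t - z' t)); intros h1 h2 h3.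
  rewrite (sq0 (x t) (x' t)), (sq0 (y t) (y' t)), (sq0 (z t) (z' t)) by lra.
  reflexivity.
Qed.

(** * The explicit loop *)

(* [a] and [b] are the extreme values of [s]; the last two equations say that
   [a], [b], [- (a + b)] are the roots of [s^3 - (3 / beta^2) s + 2]. *)
Definition turning_points (beta a b : R) : Prop :=
  0 < beta /\ 0 < a < 1 /\ 1 < b /\ a * b * (a + b) = 2 /\
  beta ^ 2 * (a ^ 2 + a * b + b ^ 2) = 3.

Definition loop_den (a b theta : R) : R := b - (b - a) * sin theta ^ 2.

(* The rate of change of [theta] along the flow. *)
Definition loop_speed (beta a b theta : R) : R :=
  beta / (2 * sqrt 3) * sqrt (b * (2 * a + b) - (b ^ 2 - a ^ 2) * sin theta ^ 2).

(** With [s = a * b / loop_den], the first coordinate is [beta * sqrt (1 / 3) * s], the second comes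
    from constancy of [x * y^2] and [a * b * (a + b) = 2], and the third is [x' / x], as
    [x' = x * z] demands. *)
Definition loop_curve (beta a b theta : R) : R3 :=
  (beta * sqrt (1 / 3) * (a * b / loop_den a b theta),
   beta * sqrt ((a + b) / 3 * loop_den a b theta),
   2 * (b - a) * sin theta * cos theta * loop_speed beta a b theta /
     loop_den a b theta).

(* The value of [x * y^2 = H_half^2] on the loop, where [x > 0]. *)
Definition level_const (beta : R) : R := beta ^ 3 * sqrt (1 / 3) * (2 / 3).

Lemma sin_sq_bound (theta : R) : 0 <= sin theta ^ 2 <= 1.
Proof. assert (h := SIN_bound theta); nra. Qed.

Lemma cos_sq (theta : R) : cos theta * cos theta = 1 - sin theta ^ 2.
Proof. assert (h := sin2_cos2 theta); unfold Rsqr in h; simpl; lra. Qed.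

Lemma loop_den_pos (a b theta : R) (hab : 0 < a < b) : 0 < loop_den a b theta.
Proof. assert (h := sin_sq_bound theta); unfold loop_den; nra. Qed.

Lemma loop_speed_radicand (a b theta : R) (hab : 0 < a < b) :
  0 < b * (2 * a + b) - (b ^ 2 - a ^ 2) * sin theta ^ 2.
Proof. assert (h := sin_sq_bound theta); nra. Qed.

Lemma loop_speed_pos (beta a b theta : R) (hb : 0 < beta) (hab : 0 < a < b) :
  0 < loop_speed beta a b theta.
Proof.
  assert (0 < sqrt 3) by (apply sqrt_lt_R0; lra).
  apply Rmult_lt_0_compat; [apply Rdiv_lt_0_compat; lra |].
  apply sqrt_lt_R0, loop_speed_radicand; exact hab.
Qed.

Lemma loop_speed_sq (beta a b theta : R) (hab : 0 < a < b) :
  loop_speed beta a b theta ^ 2 =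
  beta ^ 2 / 12 * (b * (2 * a + b) - (b ^ 2 - a ^ 2) * sin theta ^ 2).
Proof.
  assert (hq : 0 < sqrt 3) by (apply sqrt_lt_R0; lra).
  assert (hr := loop_speed_radicand a b theta hab).
  unfold loop_speed; rewrite Rpow_mult_distr, pow2_sqrt by lra.
  replace ((beta / (2 * sqrt 3)) ^ 2) with (beta ^ 2 / (4 * sqrt 3 ^ 2)) by (field; lra).
  rewrite pow2_sqrt by lra; field.
Qed.

Lemma pow2_eq_pos (u w : R) (hu : 0 < u) (hw : 0 < w) : u ^ 2 = w ^ 2 -> u = w.
Proof. intro h; nra. Qed.

(** All quantities are positive on this loop, so the level equation can be squared; this removes the
    absolute value and the root of [x]. *)
Lemma level_set_start (beta x y z : R) (hb : 0 < beta) :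
  loop_level_set (start beta) (x, y, z) <->
  0 < x /\ 0 < y /\ x ^ 2 + y ^ 2 + z ^ 2 = 1 /\ x * y ^ 2 = level_const beta.
Proof.
  assert (h1 : 0 < sqrt (1 / 3)) by (apply sqrt_lt_R0; lra).
  assert (h2 : 0 < sqrt (2 / 3)) by (apply sqrt_lt_R0; lra).
  assert (hx0 : 0 < beta * sqrt (1 / 3)) by nra.
  assert (hy0 : 0 < beta * sqrt (2 / 3)) by nra.
  assert (hlev : (sqrt (beta * sqrt (1 / 3)) * (beta * sqrt (2 / 3))) ^ 2 =
                 level_const beta).
  { rewrite !Rpow_mult_distr, !pow2_sqrt by lra; unfold level_const; ring. }
  assert (hlev0 : 0 < sqrt (beta * sqrt (1 / 3)) * (beta * sqrt (2 / 3))).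
  { apply Rmult_lt_0_compat; [apply sqrt_lt_R0 |]; lra. }
  unfold loop_level_set, on_sphere, H_half, start; simpl fst.
  rewrite (Rabs_pos_eq (beta * sqrt (1 / 3))) by lra.
  split.
  - intros [hs [hH hx]].
    assert (hx' : 0 < x) by nra.
    rewrite Rabs_pos_eq in hH by lra.
    assert (hq : 0 < sqrt x) by (apply sqrt_lt_R0; lra).
    assert (hy' : 0 < y) by nra.
    repeat split; try assumption.
    rewrite <- hlev, <- hH, Rpow_mult_distr, pow2_sqrt by lra; ring.
  - intros [hx [hy [hs hH]]].
    assert (hq : 0 < sqrt x) by (apply sqrt_lt_R0; lra).
    repeat split; [assumption | | nra].
    rewrite Rabs_pos_eq by lra.
    apply pow2_eq_pos; [nra | exact hlev0 |].
    rewrite hlev, Rpow_mult_distr, pow2_sqrt by lra; exact hH.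
Qed.

Lemma loop_curve_level_set (beta a b theta : R) (H : turning_points beta a b) :
  loop_level_set (start beta) (loop_curve beta a b theta).
Proof.
  destruct H as [hb [ha [hb1 [hprod hsum]]]].
  assert (h1 : 0 < sqrt (1 / 3)) by (apply sqrt_lt_R0; lra).
  assert (hD := loop_den_pos a b theta ltac:(lra)).
  assert (hyr : 0 < (a + b) / 3 * loop_den a b theta) by nra.
  unfold loop_curve; apply level_set_start; [exact hb |].
  split; [| split; [| split]].
  - repeat apply Rmult_lt_0_compat; try lra; apply Rinv_0_lt_compat; exact hD.
  - apply Rmult_lt_0_compat; [exact hb | apply sqrt_lt_R0; exact hyr].
  - rewrite !Rpow_mult_distr, !pow2_sqrt by lra.
    replace ((2 * (b - a) * sin theta * cos theta * loop_speed beta a b theta /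
              loop_den a b theta) ^ 2)
      with (4 * (b - a) ^ 2 * sin theta ^ 2 * (cos theta * cos theta) *
            loop_speed beta a b theta ^ 2 / loop_den a b theta ^ 2) by (field; lra).
    rewrite cos_sq, loop_speed_sq by lra.
    (* The sum of squares is independent of [theta], as a rational identity in [sin theta]; [hsum]
       then makes it 1. *)
    transitivity (beta ^ 2 * (a ^ 2 + a * b + b ^ 2) / 3); [| lra].
    unfold loop_den in *; field; lra.
  - rewrite Rpow_mult_distr, pow2_sqrt by lra.
    unfold level_const; rewrite <- hprod; field; lra.
Qed.

Lemma loop_curve_neg (beta a b theta : R) :
  loop_curve beta a b (- theta) =
  let '(x, y, z) := loop_curve beta a b theta in (x, y, - z).
Proof.
  unfold loop_curve, loop_speed, loop_den; rewrite sin_neg, cos_neg.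
  replace ((- sin theta) ^ 2) with (sin theta ^ 2) by ring.
  f_equal; unfold Rdiv; ring.
Qed.

Lemma loop_curve_PI (beta a b theta : R) :
  loop_curve beta a b (theta + PI) = loop_curve beta a b theta.
Proof.
  unfold loop_curve, loop_speed, loop_den; rewrite neg_sin, neg_cos.
  replace ((- sin theta) ^ 2) with (sin theta ^ 2) by ring.
  f_equal; unfold Rdiv; ring.
Qed.

(** The first coordinate determines [sin theta ^ 2], hence the speed, and then the third determines
    [sin theta * cos theta]. These two fix the angle modulo [PI]: [sin (theta - eta) ^ 2] expands in
    them to 0. *)
Lemma loop_curve_inj (beta a b theta eta : R) (H : turning_points beta a b)
  (hlt : Rabs (theta - eta) < PI) :
  loop_curve beta a b theta = loop_curve beta a b eta -> theta = eta.
Proof.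
  destruct H as [hb [ha [hb1 [hprod hsum]]]].
  intro E.
  assert (h1 : 0 < sqrt (1 / 3)) by (apply sqrt_lt_R0; lra).
  assert (hD := loop_den_pos a b theta ltac:(lra)).
  assert (hD' := loop_den_pos a b eta ltac:(lra)).
  assert (hV := loop_speed_pos beta a b theta hb ltac:(lra)).
  unfold loop_curve in E; injection E as Ex _ Ez.
  assert (ED : loop_den a b theta = loop_den a b eta).
  { apply Rmult_eq_reg_l in Ex; [| nra].
    apply Rmult_eq_reg_l in Ex; [| nra].
    apply (f_equal Rinv) in Ex; rewrite !Rinv_inv in Ex; exact Ex. }
  assert (ES : sin theta ^ 2 = sin eta ^ 2).
  { unfold loop_den in ED; apply Rmult_eq_reg_l with (b - a); lra. }
  assert (EV : loop_speed beta a b theta = loop_speed beta a b eta)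
    by (unfold loop_speed; rewrite ES; reflexivity).
  assert (EC : sin theta * cos theta = sin eta * cos eta).
  { rewrite <- ED, <- EV in Ez.
    apply Rmult_eq_reg_r with (2 * (b - a) * loop_speed beta a b theta *
                               / loop_den a b theta).
    - unfold Rdiv in Ez; lra.
    - apply Rinv_0_lt_compat in hD; apply Rgt_not_eq.
      apply Rmult_lt_0_compat; [apply Rmult_lt_0_compat; lra | exact hD]. }
  assert (hs : sin (theta - eta) = 0).
  { apply Rsqr_0_uniq; unfold Rsqr; rewrite sin_minus.
    replace (_ * _) with (sin theta ^ 2 * (cos eta * cos eta) +
      sin eta ^ 2 * (cos theta * cos theta) -
      2 * (sin theta * cos theta) * (sin eta * cos eta)) by ring.
    rewrite <- EC.
    replace (2 * (sin theta * cos theta) * (sin theta * cos theta))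
      with (2 * sin theta ^ 2 * (cos theta * cos theta)) by ring.
    rewrite !cos_sq, <- ES; ring. }
  apply Rabs_def2 in hlt.
  destruct (Rtotal_order theta eta) as [h | [h | h]]; [| exact h |].
  - assert (0 < sin (- (theta - eta))) by (apply sin_gt_0; lra).
    rewrite sin_neg in *; lra.
  - assert (0 < sin (theta - eta)) by (apply sin_gt_0; lra); lra.
Qed.

Lemma loop_curve_surj (beta a b : R) (p : R3) (H : turning_points beta a b) :
  loop_level_set (start beta) p ->
  exists theta, - (PI / 2) <= theta <= PI / 2 /\ loop_curve beta a b theta = p.
Proof.
  intro hp.
  assert (Hlev := fun theta => loop_curve_level_set beta a b theta H).
  destruct H as [hb [ha [hb1 [hprod hsum]]]].
  destruct p as [[x y] z]; apply level_set_start in hp; [| exact hb].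
  destruct hp as [hx [hy [hs hH]]].
  assert (h1 : 0 < sqrt (1 / 3)) by (apply sqrt_lt_R0; lra).
  assert (hq : sqrt (1 / 3) * sqrt (1 / 3) = 1 / 3) by (apply sqrt_sqrt; lra).
  set (k := beta * sqrt (1 / 3)).
  assert (hk : 0 < k) by (unfold k; nra).
  assert (hk2 : k ^ 2 * (a ^ 2 + a * b + b ^ 2) = 1).
  { unfold k; rewrite Rpow_mult_distr, pow2_sqrt by lra; lra. }
  set (s := x / k).
  assert (hs0 : 0 < s) by (apply Rdiv_lt_0_compat; assumption).
  assert (hxs : x = k * s) by (unfold s; field; lra).
  assert (hlev : level_const beta = 2 * k ^ 3).
  { unfold level_const, k.
    replace (2 * (beta * sqrt (1 / 3)) ^ 3)
      with (2 * beta ^ 3 * sqrt (1 / 3) * (sqrt (1 / 3) * sqrt (1 / 3))) by ring.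
    rewrite hq; field. }
  rewrite hlev, hxs in hH.
  assert (hy2 : s * y ^ 2 = 2 * k ^ 2).
  { apply Rmult_eq_reg_l with k; [| lra]. lra. }
  (* Eliminating [x] and [y] leaves the factored cubic; as its left side is nonnegative, [s] lies
     between [a] and [b]. *)
  assert (hfac : s * z ^ 2 = k ^ 2 * ((b - s) * (s - a) * (s + a + b))).
  { replace (z ^ 2) with (1 - x ^ 2 - y ^ 2) by lra.
    replace (s * (1 - x ^ 2 - y ^ 2)) with (s - s * x ^ 2 - s * y ^ 2) by ring.
    rewrite hy2, hxs, <- hprod.
    transitivity (s * (k ^ 2 * (a ^ 2 + a * b + b ^ 2)) - s * (k * s) ^ 2 -
                  a * b * (a + b) * k ^ 2); [rewrite hk2 |]; ring. }
  assert (hmid : 0 <= (b - s) * (s - a)).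
  { assert (hz := pow2_ge_0 z).
    assert (0 <= s * z ^ 2) by nra.
    assert (0 < k ^ 2 * (s + a + b)) by (apply Rmult_lt_0_compat; nra).
    apply Rmult_le_reg_l with (k ^ 2 * (s + a + b)); [assumption | lra]. }
  assert (hsab : a <= s <= b) by nra.
  (* The value of [sin theta ^ 2] solving [s = a * b / loop_den a b theta]. *)
  set (S := b * (s - a) / ((b - a) * s)).
  assert (hS : 0 <= S <= 1).
  { assert (hpos : 0 < (b - a) * s) by nra.
    unfold S; split.
    - apply Rmult_le_pos; [nra | left; apply Rinv_0_lt_compat; exact hpos].
    - apply Rmult_le_reg_r with ((b - a) * s); [exact hpos |].
      unfold Rdiv; rewrite Rmult_assoc, Rinv_l by lra; nra. }
  assert (hsq : 0 <= sqrt S <= 1).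
  { split; [apply sqrt_pos |]. rewrite <- sqrt_1; apply sqrt_le_1_alt; lra. }
  set (theta := asin (sqrt S)).
  assert (hth : - (PI / 2) <= theta <= PI / 2) by apply asin_bound.
  assert (hsin : sin theta ^ 2 = S).
  { unfold theta; rewrite sin_asin, pow2_sqrt by lra; reflexivity. }
  assert (hden : loop_den a b theta = a * b / s).
  { unfold loop_den; rewrite hsin; unfold S; field; lra. }
  assert (hneg := loop_curve_neg beta a b theta).
  specialize (Hlev theta).
  assert (Ex : fst (fst (loop_curve beta a b theta)) = x).
  { unfold loop_curve; simpl fst; rewrite hden; fold k; rewrite hxs; field; lra. }
  destruct (loop_curve beta a b theta) as [[x' y'] z'] eqn:Ec.
  simpl in Ex; subst x'.
  apply level_set_start in Hlev; [| exact hb].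
  destruct Hlev as [_ [hy' [hs' hH']]].
  rewrite hlev, hxs in hH'.
  assert (Ey : y' = y).
  { apply pow2_eq_pos; try assumption. apply Rmult_eq_reg_l with (k * s); nra. }
  subst y'.
  (* Equal [x] and [y] leave only the sign of [z] open; [theta] and [- theta] realize both signs. *)
  assert (Ez : z' ^ 2 = z ^ 2) by lra.
  rewrite <- !Rsqr_pow2 in Ez; apply Rsqr_eq in Ez.
  destruct Ez as [Ez | Ez].
  - exists theta; rewrite Ec, Ez; split; [exact hth | reflexivity].
  - exists (- theta); rewrite hneg, Ez; split; [lra |].
    rewrite Ropp_involutive; reflexivity.
Qed.

(** * The explicit loop as a flow line *)

Lemma is_derive_loop_den (a b theta : R) :
  is_derive (fun x : R => loop_den a b x) theta
    (- (2 * (b - a) * sin theta * cos theta)).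
Proof. unfold loop_den; auto_derive; [exact I | ring]. Qed.

Lemma is_derive_loop_speed (beta a b theta : R) (hb : 0 < beta) (hab : 0 < a < b) :
  is_derive (fun x : R => loop_speed beta a b x) theta
    (- (beta ^ 2 / 12 * (b ^ 2 - a ^ 2) * sin theta * cos theta) /
     loop_speed beta a b theta).
Proof.
  assert (h3 : 0 < sqrt 3) by (apply sqrt_lt_R0; lra).
  assert (hrad := loop_speed_radicand a b theta hab).
  assert (hc : beta ^ 2 / 12 = (beta / (2 * sqrt 3)) ^ 2).
  { replace 12 with (4 * (sqrt 3 * sqrt 3)) by (rewrite sqrt_sqrt; lra).
    field; lra. }
  assert (hA : 0 < sqrt (b * (2 * a + b) - (b ^ 2 - a ^ 2) * sin theta ^ 2))
    by (apply sqrt_lt_R0; exact hrad).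
  unfold loop_speed; auto_derive; [exact hrad |].
  match goal with |- context [/ (2 * sqrt ?A)] =>
    change A with (b * (2 * a + b) - (b ^ 2 - a ^ 2) * sin theta ^ 2) end.
  rewrite hc; field; repeat split; lra.
Qed.

Lemma is_derive_loop_curve (beta a b : R) (f : R -> R) (t : R)
  (H : turning_points beta a b)
  (hf : is_derive (fun s : R => f s) t (loop_speed beta a b (f t))) :
  is_derive (fun s => loop_curve beta a b (f s)) t (Sigma (loop_curve beta a b (f t))).
Proof.
  destruct H as [hb [ha [hb1 [hprod hsum]]]].
  assert (h1 : 0 < sqrt (1 / 3)) by (apply sqrt_lt_R0; lra).
  assert (hD := loop_den_pos a b (f t) ltac:(lra)).
  assert (hV := loop_speed_pos beta a b (f t) hb ltac:(lra)).
  assert (hV2 := loop_speed_sq beta a b (f t) ltac:(lra)).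
  assert (hyr : 0 < (a + b) / 3 * loop_den a b (f t)) by nra.
  assert (hC := cos_sq (f t)).
  assert (hdD := is_derive_loop_den a b (f t)).
  assert (hdV := is_derive_loop_speed beta a b (f t) hb ltac:(lra)).
  apply is_derive_R3; unfold loop_curve; simpl fst; simpl snd; split; [| split].
  - auto_derive.
    + repeat split; (eexists; eassumption) || lra.
    + rewrite (is_derive_unique _ _ _ hdD), (is_derive_unique _ _ _ hf); field; lra.
  - assert (hA : 0 < sqrt ((a + b) / 3 * loop_den a b (f t)))
      by (apply sqrt_lt_R0; exact hyr).
    assert (hA2 := sqrt_sqrt _ (Rlt_le _ _ hyr)).
    auto_derive.
    + repeat split; (eexists; eassumption) || exact hyr.
    + rewrite (is_derive_unique _ _ _ hdD), (is_derive_unique _ _ _ hf).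
      change ((a + b) * / 3) with ((a + b) / 3).
      set (q := sqrt ((a + b) / 3 * loop_den a b (f t))) in *.
      transitivity (- (beta * ((a + b) / 3 * loop_den a b (f t)) / q *
        ((b - a) * sin (f t) * cos (f t) * loop_speed beta a b (f t) /
         loop_den a b (f t)))); [| rewrite <- hA2]; field; lra.
  - auto_derive.
    + repeat split; (eexists; eassumption) || lra.
    + rewrite (is_derive_unique _ _ _ hdD), (is_derive_unique _ _ _ hdV),
        (is_derive_unique _ _ _ hf).
      rewrite !Rpow_mult_distr, !pow2_sqrt by lra.
      set (V := loop_speed beta a b (f t)) in *.
      set (S := sin (f t)) in *; set (C := cos (f t)) in *.
      (* The chain rule multiplies the derivative of the speed by [V], cancelling its denominator.
         So [V] enters only squared, and [hV2] and [hC] leave a rational identity in [S]. *)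
      transitivity (2 * (b - a) / loop_den a b (f t) *
        (V ^ 2 * (C * C - S ^ 2 + 2 * (b - a) * S ^ 2 * (C * C) / loop_den a b (f t))
         - beta ^ 2 / 12 * (b ^ 2 - a ^ 2) * (S ^ 2 * (C * C)))); [field; lra |].
      rewrite hC, hV2; fold S; unfold loop_den in *; fold S in hD |- *.
      field; lra.
Qed.

(** * Time parametrization and period of the loop *)

Lemma start_level_set (beta : R) (hb : 0 < beta < 1) :
  loop_level_set (start beta) (start beta).
Proof.
  assert (0 < sqrt (1 / 3)) by (apply sqrt_lt_R0; lra).
  assert (0 < sqrt (2 / 3)) by (apply sqrt_lt_R0; lra).
  unfold start at 2; apply level_set_start; [lra |].
  assert (beta ^ 2 < 1) by nra.
  rewrite !Rpow_mult_distr, !pow2_sqrt by lra.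
  repeat split; [nra | nra | lra | unfold level_const; ring].
Qed.

Lemma is_loop_period_curve (beta a b m kappa : R) (hb1 : beta < 1)
  (H : turning_points beta a b) (hm : 0 <= m < 1) (hk : 0 < kappa)
  (hspeed : forall theta,
     loop_speed beta a b theta = kappa * sqrt (1 - m * sin theta ^ 2)) :
  is_loop_period (start beta) (2 * elliptic_K m / kappa).
Proof.
  assert (hpi := PI_RGT_0).
  assert (hb : 0 < beta < 1) by (destruct H; lra).
  destruct (loop_curve_surj beta a b _ H (start_level_set beta hb)) as [th0 [hth0 E0]].
  destruct (elliptic_amplitude m hm) as [am [hF ham]].
  assert (hmono : forall x y, elliptic_F m x < elliptic_F m y <-> x < y).
  { intros x y; split; intro h.
    - apply Rnot_le_lt; intro h'; assert (h1 := elliptic_F_expand m y x hm h'); lra.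
    - assert (h1 := elliptic_F_expand m x y hm (Rlt_le _ _ h)); lra. }
  assert (ham0 : forall x, am (elliptic_F m x) = x).
  { intro x; assert (h := hF (elliptic_F m x)).
    destruct (Rtotal_order (am (elliptic_F m x)) x) as [h' | [h' | h']];
      [| exact h' |]; apply hmono in h'; lra. }
  (* The start has [s = 1], strictly between [a] and [b], so [th0] is not 0 and the elliptic
     argument needs the phase [u0]. *)
  set (u0 := elliptic_F m th0).
  set (th := fun t => am (u0 + kappa * t)).
  set (T := 2 * elliptic_K m / kappa).
  assert (hK : 0 < elliptic_K m).
  { assert (h := elliptic_F_expand m 0 (PI / 2) hm ltac:(lra)).
    rewrite elliptic_F_0 in h; change (elliptic_K m) with (elliptic_F m (PI / 2)); lra. }
  assert (hT : 0 < T) by (apply Rdiv_lt_0_compat; lra).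
  assert (hkT : kappa * T = 2 * elliptic_K m) by (unfold T; field; lra).
  assert (hthF : forall t, elliptic_F m (th t) = u0 + kappa * t) by (intro; apply hF).
  assert (hth_0 : th 0 = th0).
  { unfold th; rewrite Rmult_0_r, Rplus_0_r; apply ham0. }
  assert (hth_T : th T = th0 + PI).
  { unfold th; rewrite hkT; unfold u0; rewrite <- elliptic_F_PI by exact hm; apply ham0. }
  assert (hth_lt : forall s t, s < t -> th s < th t).
  { intros s t hst; apply hmono; rewrite !hthF; nra. }
  set (g := fun t => loop_curve beta a b (th t)).
  assert (hg : flow_line (start beta) g).
  { split; [unfold g; rewrite hth_0; exact E0 | intro t].
    apply is_derive_loop_curve; [exact H |].
    rewrite hspeed; unfold th.
    assert (hd := ham (u0 + kappa * t)).
    auto_derive; [eexists; exact hd |].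
    rewrite (is_derive_unique (fun x : R => am x) _ _ hd); ring. }
  split; [exists g; exact hg | intros g' hg'].
  (* Forward uniqueness suffices: [once_around] inspects only times in [[0, T]]. *)
  assert (Eg : forall t, 0 <= t -> g' t = g t).
  { intros t ht; apply (flow_line_unique (start beta)); try assumption.
    apply (start_level_set beta hb). }
  split; [exact hT |]. split; [| split].
  - rewrite !Eg by lra; unfold g; rewrite hth_T, hth_0; apply loop_curve_PI.
  - assert (hlt : forall s t, 0 <= s < T -> 0 <= t < T -> s < t -> g s <> g t).
    { intros s t hs ht hst e.
      assert (h1 := hth_lt s t hst).
      assert (h2 := hth_lt t T ltac:(lra)).
      (* Both angles lie in the half-open interval from [th0] to [th0 + PI], so they differ by
         strictly less than [PI]. *)
      assert (h3 : th 0 <= th s)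
        by (destruct (Req_dec s 0) as [-> | n]; [lra | left; apply hth_lt; lra]).
      apply loop_curve_inj in e; [lra | exact H |].
      apply Rabs_def1; lra. }
    intros s t hs ht e; rewrite !Eg in e by lra.
    destruct (Rtotal_order s t) as [h | [h | h]]; [| exact h |].
    + exfalso; exact (hlt s t hs ht h e).
    + exfalso; exact (hlt t s ht hs h (eq_sym e)).
  - intro p; split.
    + intro hp; destruct (loop_curve_surj beta a b p H hp) as [eta [heta Ep]].
      (* Both [eta] and [th0] lie in [[- PI / 2, PI / 2]], so at most one shift by [PI] is needed.
         The downward shift covers only the opposite endpoints. *)
      assert (hshift : exists eta', th0 <= eta' < th0 + PI /\
                         loop_curve beta a b eta' = p).
      { destruct (Rlt_le_dec eta th0); [| destruct (Rlt_le_dec eta (th0 + PI))].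
        - exists (eta + PI); rewrite loop_curve_PI; split; [lra | exact Ep].
        - exists eta; split; [lra | exact Ep].
        - exists (eta - PI); split; [lra |].
          rewrite <- loop_curve_PI; replace (eta - PI + PI) with eta by ring; exact Ep. }
      clear eta heta Ep; destruct hshift as [eta [[h1 h2] Ep]].
      assert (h3 := elliptic_F_expand m th0 eta hm h1).
      apply hmono in h2; rewrite elliptic_F_PI in h2 by exact hm; fold u0 in h2, h3.
      assert (hkt : kappa * ((elliptic_F m eta - u0) / kappa) = elliptic_F m eta - u0)
        by (field; lra).
      assert (ht : 0 <= (elliptic_F m eta - u0) / kappa < T).
      { split; apply Rnot_lt_le || apply Rnot_le_lt; intro; nra. }
      exists ((elliptic_F m eta - u0) / kappa); split; [exact ht |].
      rewrite Eg by lra; unfold g, th; rewrite hkt.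
      replace (u0 + (elliptic_F m eta - u0)) with (elliptic_F m eta) by ring.
      rewrite ham0; exact Ep.
    + intros [t [ht <-]]; rewrite Eg by lra.
      apply loop_curve_level_set; exact H.
Qed.

Theorem corollary3p4 (beta : R) (hbeta : 0 < beta < 1) :
  exists t0 t1 : R,
    RtoC t0 =
      Clog (1 / beta *
            (1 / Ccbrt (- beta ^ 3 + Csqrt (-(1) + beta ^ 6))
             + Ccbrt (- beta ^ 3 + Csqrt (-(1) + beta ^ 6))))%C /\
    RtoC t1 =
      Clog (1 / 2 *
            (1 / beta ^ 2
             + 1 / (beta ^ 4 *
                    Ccbrt (-(2) + 1 / beta ^ 6
                           + 2 * Csqrt (-(1) + beta ^ 6) / beta ^ 3))
             + Ccbrt (-(2) + 1 / beta ^ 6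
                      + 2 * Csqrt (-(1) + beta ^ 6) / beta ^ 3)))%C /\
    is_loop_period (start beta)
      (4 * sqrt 3 / (beta * sqrt (exp (t0 - t1) + 2 * exp t1)) *
       elliptic_K (2 * (exp t1 - exp (- t0)) / (exp (t0 - t1) + 2 * exp t1))).
Proof.
  destruct (cubic_roots beta hbeta) as [a [b [ha [hb [hprod [hsum [Eb Ea]]]]]]].
  exists (ln b), (ln (/ a)).
  assert (hia : 0 < / a) by (apply Rinv_0_lt_compat; lra).
  split; [| split].
  - rewrite log_argument0, Eb, Clog_RtoC by (exact hbeta || lra); reflexivity.
  - rewrite log_argument1, Ea, Clog_RtoC by (exact hbeta || lra); reflexivity.
  - rewrite ln_Rinv by lra.
    replace (ln b - - ln a) with (ln b + ln a) by ring.
    rewrite exp_plus, exp_Ropp, exp_Ropp, !exp_ln by lra.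
    (* The relation [a * b * (a + b) = 2] turns the reciprocals into polynomials, matching the
       radicand of [loop_speed]. *)
    assert (e2 : 2 * / a = b * (a + b)) by (rewrite <- hprod; field; lra).
    assert (e2' : 2 * / b = a * (a + b)) by (rewrite <- hprod; field; lra).
    replace (2 * (/ a - / b)) with (b ^ 2 - a ^ 2) by lra.
    rewrite e2.
    replace (b * a + b * (a + b)) with (b * (2 * a + b)) by ring.
    assert (hA : 0 < b * (2 * a + b)) by nra.
    assert (hqA : 0 < sqrt (b * (2 * a + b))) by (apply sqrt_lt_R0; exact hA).
    assert (hq : 0 < sqrt 3) by (apply sqrt_lt_R0; lra).
    (* Factoring [b * (2 * a + b)] out of that radicand leaves [1 - m * sin theta ^ 2]; here [m < 1]
       because [b ^ 2 - a ^ 2 < b ^ 2 + 2 * a * b]. *)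
    set (m := (b ^ 2 - a ^ 2) / (b * (2 * a + b))).
    assert (hmA : b * (2 * a + b) * m = b ^ 2 - a ^ 2) by (unfold m; field; lra).
    replace (4 * sqrt 3 / (beta * sqrt (b * (2 * a + b))) * elliptic_K m)
      with (2 * elliptic_K m / (beta / (2 * sqrt 3) * sqrt (b * (2 * a + b))))
      by (field; lra).
    assert (hm : 0 <= m < 1) by (split; nra).
    apply (is_loop_period_curve beta a b).
    + lra.
    + unfold turning_points; repeat split; lra.
    + exact hm.
    + apply Rmult_lt_0_compat; [apply Rdiv_lt_0_compat |]; lra.
    + intro theta; unfold loop_speed.
      rewrite Rmult_assoc, <- sqrt_mult_alt, <- hmA by lra.
      do 2 f_equal; ring.
Qed.
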